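(* For every integer $n \ge 1$, $\omega(n) \in \mathbb{N}$.
   Context: For $n \ge 1$ let $M_n = 2^n - 1$, let $F(n) = \prod_{i=1}^n M_i$ (with $F(0)=1$), and let $\omega(n) = \frac{2^{n-1} F(n-1)}{n!} \in \mathbb{Q}$. *)

(* Defs.v *)
From mathcomp Require Import all_boot all_order all_algebra.

Set Implicit Arguments.
Unset Strict Implicit.
Unset Printing Implicit Defensive.

Import GRing.Theory Num.Theory.

Local Open Scope ring_scope.

(* The truncated subtraction on nat is exact here since 1 <= 2 ^ n. *)
Definition M (n : nat) : nat := (2 ^ n - 1)%N.

Definition F (n : nat) : nat := (\prod_(1 <= i < n.+1) M i)%N.

(* Meaningful for 1 <= n, where n.-1 is n - 1; the division is in rat. *)
Definition omega (n : nat) : rat := (2 ^ n.-1 * F n.-1)%N%:R / (n`!)%:R.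

(* Main.v *)
Require Import Defs.
From mathcomp Require Import all_boot all_order all_algebra.
From mathcomp Require Import cyclic.

(** The claim is that [n!] divides [2^(n-1) F(n-1)], which is checked one prime
at a time.

For [p = 2], Legendre's formula writes [v_2(n!)] as the sum of the integer parts
of [n/2, n/4, ...].  It is less than [n], so the factor [2^(n-1)] suffices
([logn2_fact_lt]).

For [p] odd, Euler's theorem says that [p^k] divides [2^i - 1] as soon as
[phi(p^k)] divides [i].  Among [1, ..., n-1] there are [(n-1) %/ phi(p^k)] such
[i], so summing over [k] gives
[v_p(F(n-1)) >= \sum_k (n-1) %/ phi(p^k)] ([leq_sum_div_totient_logn]).
Legendre's formula is [v_p(n!) = \sum_k n %/ p^k], and the two sums compare term
by term because [phi(p^k) < p^k] ([leq_divn_pred], [totient_pfactor_lt]). *)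

Local Open Scope ring_scope.

(** The smaller divisor makes up for the loss of one unit: if [m > 0] multiples
of [d] fit below [n], then [m * e <= m * d - m <= n - m <= n - 1]. *)
Lemma leq_divn_pred (n d e : nat) :
  (0 < e)%N -> (e < d)%N -> (n %/ d <= n.-1 %/ e)%N.
Proof.
move=> e0 lted; rewrite leq_divRL //.
have [->//|q0] := posnP (n %/ d)%N.
have lt_n : (n %/ d * e < n)%N.
  by rewrite (leq_trans _ (leq_divM n d)) // ltn_pmul2l.
by rewrite -ltnS prednK // (leq_trans _ lt_n).
Qed.

(** The [k > 0] with [p^k] dividing [m] are [1, ..., v_p(m)]; cutting the range
at [K] can only lose some of them. *)
Lemma leq_sum_dvdn_logn (p m K : nat) : prime p -> (0 < m)%N ->
  (\sum_(1 <= k < K.+1) (p ^ k %| m) <= logn p m)%N.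
Proof.
move=> p_pr m0.
(* The number of terms bounds the sum too, and the induction on [K] needs both. *)
suff: (\sum_(1 <= k < K.+1) (p ^ k %| m) <= minn K (logn p m))%N.
  by move/leq_trans; apply; apply: geq_minr.
elim: K => [|K IH]; first by rewrite big_geq.
rewrite big_nat_recr //= pfactor_dvdn //.
case: leqP => [_|ltKv] /=.
  by rewrite addn0 (leq_trans IH) // leq_min geq_minr geq_min leqW ?leqnn.
by rewrite addn1 (minn_idPl ltKv) ltnS (leq_trans IH) ?geq_minl.
Qed.

(** Since [n %/ 2^(k+1)] is [(n %/ 2) %/ 2^k], the sum for [n] is
[n %/ 2] plus the sum for [n %/ 2]; by induction the latter is less than
[n %/ 2], unless [n %/ 2 = 0]. *)
Lemma ltn_sum_div_exp2 (K n : nat) : (0 < n)%N ->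
  (\sum_(1 <= k < K.+1) n %/ 2 ^ k < n)%N.
Proof.
elim: K n => [|K IH] n n0; first by rewrite big_geq.
rewrite big_nat_recl // expn1.
under eq_bigr do rewrite expnS divnMA.
have [->|/IH lt_half] := posnP (n %/ 2)%N.
  by rewrite big1 // => k _; rewrite div0n.
apply: leq_trans (leq_divM n 2).
by rewrite muln2 -addnn ltn_add2l.
Qed.

Lemma logn2_fact_lt (n : nat) : (0 < n)%N -> (logn 2 n`! < n)%N.
Proof. by move=> n0; rewrite logn_fact // ltn_sum_div_exp2. Qed.

Lemma M_gt0 (i : nat) : (0 < i)%N -> (0 < M i)%N.
Proof. by move=> i0; rewrite subn_gt0 -(expn0 2) ltn_exp2l. Qed.

Lemma F_gt0 (n : nat) : (0 < F n)%N.
Proof.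
rewrite /F big_nat_cond; apply: prodn_cond_gt0 => i /andP[/andP[i0 _] _].
exact: M_gt0.
Qed.

Lemma FS (n : nat) : F n.+1 = (F n * M n.+1)%N.
Proof. by rewrite /F big_nat_recr. Qed.

Lemma logn_F (p n : nat) : logn p (F n) = (\sum_(1 <= i < n.+1) logn p (M i))%N.
Proof.
elim: n => [|n IH]; first by rewrite /F !big_geq // logn1.
by rewrite FS lognM ?F_gt0 ?M_gt0 // IH [RHS]big_nat_recr.
Qed.

(** Euler's theorem for the base [2], which is a unit modulo an odd [d]. *)
Lemma dvdn_M_totient (d i : nat) : odd d -> (totient d %| i)%N -> (d %| M i)%N.
Proof.
move=> odd_d /dvdnP[q ->].
rewrite /M -eqn_mod_dvd ?expn_gt0 // mulnC expnM -modnXm.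
by rewrite Euler_exp_totient ?coprime2n // modnXm exp1n.
Qed.

(** For each [k] the multiples [i] of [phi(p^k)] up to [n] are counted; every
such pair [(k, i)] contributes a factor [p] to [M i], because [p^k] divides it. *)
Lemma leq_sum_div_totient_logn (p n K : nat) : prime p -> odd p ->
  (\sum_(1 <= k < K.+1) n %/ totient (p ^ k) <= logn p (F n))%N.
Proof.
move=> p_pr odd_p; rewrite logn_F.
under eq_bigr do rewrite divn_count_dvd.
rewrite exchange_big_nat /= big_nat [leqRHS]big_nat.
apply: leq_sum => i /andP[i0 _].
apply: leq_trans (leq_sum_dvdn_logn p (M i) K p_pr (M_gt0 i i0)).
apply: leq_sum => k _.
case: (boolP (totient (p ^ k) %| i)%N) => // dvd_i.
by rewrite dvdn_M_totient // oddX odd_p orbT.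
Qed.

Lemma totient_pfactor_lt (p k : nat) : prime p -> (0 < k)%N ->
  (totient (p ^ k) < p ^ k)%N.
Proof.
move=> p_pr k0; rewrite totient_pfactor // -[in ltnRHS](prednK k0) expnS.
by rewrite ltn_pmul2r ?expn_gt0 ?prime_gt0 // prednK ?prime_gt0.
Qed.

Lemma logn_fact_leq_F (p n : nat) : prime p -> odd p ->
  (logn p n`! <= logn p (F n.-1))%N.
Proof.
move=> p_pr odd_p; rewrite logn_fact //.
apply: leq_trans (leq_sum_div_totient_logn p n.-1 n p_pr odd_p).
rewrite big_nat [leqRHS]big_nat; apply: leq_sum => k /andP[k0 _].
apply: leq_divn_pred; last exact: totient_pfactor_lt.
by rewrite totient_gt0 expn_gt0 prime_gt0.
Qed.

Theorem proposition2p2 (n : nat) (hn : (1 <= n)%N) : omega n \is a Num.nat.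
Proof.
apply/Qnat_dvd/dvdn_partP; first exact: fact_gt0.
move=> p; rewrite mem_primes => /andP[p_pr _]; rewrite p_part.
have [->|odd_p] := even_prime p_pr.
  by rewrite dvdn_mulr // dvdn_exp2l // -ltnS prednK // logn2_fact_lt.
by rewrite dvdn_mull // pfactor_dvdn ?F_gt0 // logn_fact_leq_F.
Qed.
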